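(* Let $\mathfrak{g}$ be a split semisimple Lie algebra over a field $K$ of characteristic $0$, with simple roots $\alpha_1,\ldots,\alpha_\ell$, Cartan matrix $C$, and canonical generators $h_i,x_{\alpha_i},x_{-\alpha_i}$ ($1\le i\le\ell$). Let $x=x_{\alpha_1}+\cdots+x_{\alpha_\ell}$ and $y=b_1x_{-\alpha_1}+\cdots+b_\ell x_{-\alpha_\ell}$ with $b_i\in K$, $b_i\neq0$ for all $i$. Let $b\in K^\ell$ be the vector with coordinates $b_i$, and write $v_1,\ldots,v_\ell$ for the coordinates of $Cb$. Suppose that $\{\pm v_i \mid 1\le i\le\ell\}$ consists of $2\ell$ distinct elements. Then $x,y$ generate $\mathfrak{g}$ as a Lie algebra.
   Context: Let $\mathfrak{h}$ be a (split) Cartan subalgebra of $\mathfrak{g}$, with corresponding root system $\Phi$, set of simple roots $\Delta=\{\alpha_1,\ldots,\alpha_\ell\}$ and Cartan matrix $C$. Canonical generators of $\mathfrak{g}$ are elements $h_i\in\mathfrak{h}$, $x_{\alpha_i}\in\mathfrak{g}_{\alpha_i}$, $x_{-\alpha_i}\in\mathfrak{g}_{-\alpha_i}$, $1\le i\le\ell$, generating $\mathfrak{g}$ and satisfying $[h_i,h_j]=0$, $[h_i,x_{\alpha_j}]=C(j,i)x_{\alpha_j}$, $[h_i,x_{-\alpha_j}]=-C(j,i)x_{-\alpha_j}$, $[x_{\alpha_i},x_{-\alpha_j}]=\delta_{i,j}h_i$. In particular $C(j,i)=\alpha_j(h_i)$. *)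

(* Defs.v *)
From HB Require Import structures.
From mathcomp Require Import all_boot all_order all_algebra.

Set Implicit Arguments.
Unset Strict Implicit.
Unset Printing Implicit Defensive.

Import GRing.Theory.
Local Open Scope ring_scope.

(* Lie algebras are finite-dimensional: the carrier is a vectType. *)
HB.mixin Record Vector_isLieAlgebra (K : fieldType) g of Vector K g := {
  lie : g -> g -> g;
  lie_linearl : forall y, linear (fun x => lie x y);
  lie_linearr : forall x, linear (lie x);
  liexx : forall x, lie x x = 0;
  lie_jacobi : forall x y z,
    lie x (lie y z) + lie y (lie z x) + lie z (lie x y) = 0
}.

#[short(type="lieAlgType")]
HB.structure Definition LieAlgebra (K : fieldType) :=
  { g of Vector K g & Vector_isLieAlgebra K g }.

HB.instance Definition _ (K : fieldType) (g : lieAlgType K) (x : g) :=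
  GRing.isLinear.Build K g g *:%R (lie x) (lie_linearr x).

Definition ad (K : fieldType) (g : lieAlgType K) (x : g) : 'End(g) :=
  linfun (lie x).

Section Subspaces.
Variables (K : fieldType) (g : lieAlgType K).
Implicit Types U V W : {vspace g}.

Definition lie_subalgebra U := {in U &, forall x y, lie x y \in U}.

Definition lie_ideal U := forall x y, y \in U -> lie x y \in U.

(* Every subalgebra is a subspace of the finite-dimensional space g, so
   quantifying over {vspace g} covers all subalgebras containing S. *)
Definition lie_generates (S : seq g) :=
  forall U, lie_subalgebra U -> {subset S <= U} -> U = fullv.

(* [U, V]; by bilinearity brackets of basis vectors suffice, see
   [lie_prod_subP]. *)
Definition lie_prod U V : {vspace g} :=
  <<allpairs (@lie K g) (vbasis U) (vbasis V)>>%VS.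

Lemma lie_prod_subP U V W :
  (forall u v, u \in U -> v \in V -> lie u v \in W) <->
  (lie_prod U V <= W)%VS.
Proof.
split=> [sUVW | sW u v Uu Vv].
  apply/span_subvP=> _ /allpairsP[[u v] [Uu Vv ->]].
  by apply: sUVW; apply: vbasis_mem.
have lielE x y : lie x y = linfun (fun z : g => lie z y) x.
  pose m := GRing.isLinear.Build K g g *:%R (fun z : g => lie z y)
              (lie_linearl y).
  pose f : {linear g -> g} := HB.pack (fun z : g => lie z y) m.
  by rewrite (lfunE f).
rewrite (coord_vbasis Uu) (coord_vbasis Vv) linear_sum memv_suml // => j _.
rewrite linearZ memvZ //= lielE linear_sum memv_suml // => i _.
rewrite linearZ memvZ //= -lielE (subvP sW) // memv_span //.
by apply: allpairs_f; apply: mem_nth; rewrite size_tuple.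
Qed.

Definition lie_solvable U :=
  exists n, iter n (fun V => lie_prod V V) U = 0%VS.

Definition lie_nilpotent U :=
  exists n, iter n (lie_prod U) U = 0%VS.

Definition cartan_subalgebra U :=
  [/\ lie_subalgebra U, lie_nilpotent U &
      forall x, (forall y, y \in U -> lie x y \in U) -> x \in U].

(* U is split when ad h has all its eigenvalues in K for every h in U, i.e.
   its characteristic polynomial splits; the basis chosen is irrelevant. *)
Definition split_cartan_subalgebra U :=
  cartan_subalgebra U /\
  forall h, h \in U -> exists s : seq K,
    char_poly (passmx.mxof (vbasis {:g}) (vbasis {:g}) (ad h)) =
    \prod_(a <- s) ('X - a%:P).

End Subspaces.

Definition semisimple (K : fieldType) (g : lieAlgType K) :=
  forall U : {vspace g}, lie_ideal U -> lie_solvable U -> U = 0%VS.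

Section Roots.
Variables (K : fieldType) (g : lieAlgType K) (H : {vspace g}).

Definition dual := 'Hom(subvs_of H, K^o).

Definition in_root_space (a : dual) (x : g) :=
  forall h : subvs_of H, lie (vsval h) x = (a h : K) *: x.

Definition is_root (a : dual) :=
  a <> 0 /\ exists2 x, x <> 0 & in_root_space a x.

Definition simple_roots l (alpha : 'I_l -> dual) :=
  [/\ forall i, is_root (alpha i),
      basis_of fullv (codom alpha) &
      forall a, is_root a -> exists n : 'I_l -> nat,
        a = \sum_i alpha i *+ n i \/ a = - \sum_i alpha i *+ n i].

(* The coroot is characterized uniquely by these two conditions because the
   roots form a finite spanning set of the dual of H (Bourbaki, Lie VI.1). *)
Definition is_coroot (a : dual) (f : 'Hom(dual, K^o)) :=
  f a = 2 /\ forall b, is_root b -> is_root (b - (f b : K) *: a).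

(* C i j is the Cartan integer < alpha i, (alpha j)^vee >. *)
Definition cartan_matrix l (alpha : 'I_l -> dual) (C : 'M[int]_l) :=
  forall j, exists2 f, is_coroot (alpha j) f &
    forall i, f (alpha i) = (C i j)%:~R.

Record canonical_generators l (alpha : 'I_l -> dual) (C : 'M[int]_l)
    (h xp xm : 'I_l -> g) : Prop := {
  cangen_h : forall i, h i \in H;
  cangen_xp : forall i, in_root_space (alpha i) (xp i);
  cangen_xm : forall i, in_root_space (- alpha i) (xm i);
  cangen_gen : lie_generates (codom h ++ codom xp ++ codom xm);
  cangen_hh : forall i j, lie (h i) (h j) = 0;
  cangen_hxp : forall i j, lie (h i) (xp j) = (C j i)%:~R *: xp j;
  cangen_hxm : forall i j, lie (h i) (xm j) = - (C j i)%:~R *: xm j;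
  cangen_xpxm : forall i j, lie (xp i) (xm j) = if i == j then h i else 0
}.

End Roots.

(* Main.v *)
(** The bracket z = [x, y] = \sum_i b_i h_i acts on x_{alpha_j} and
    x_{-alpha_j} by the scalars v_j and - v_j. Since the v_j are pairwise
    distinct, applying polynomials in ad z to x and to y isolates every
    x_{alpha_j} and every b_j x_{-alpha_j}. *)
Require Import Defs.
From mathcomp Require Import all_boot all_order all_algebra.

Import GRing.Theory.
Local Open Scope ring_scope.

(* Applying \prod_(k != i) (f - a k) to the sum kills all e j with j != i. *)
Lemma memv_eigenvector_sum (K : fieldType) (V : vectType K)
    (f : {linear V -> V}) (U : {vspace V}) (I : finType)
    (a : I -> K) (e : I -> V) :
    (forall u, u \in U -> f u \in U) ->
    (forall i, f (e i) = a i *: e i) -> injective a ->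
    \sum_i e i \in U ->
  forall i, e i \in U.
Proof.
move=> fU fe a_inj sumU i.
(* The sum displayed is the image of [\sum_i e i] under the product of the operators [f - a k] for
   [k] in [s]; each factor preserves [U]. An arbitrary list [s] allows induction. *)
have prodU (s : seq I) : \sum_j (\prod_(k <- s) (a j - a k)) *: e j \in U.
  elim: s => [|k s IHs].
    by under eq_bigr => j _ do rewrite big_nil scale1r.
  set w := \sum_j _ in IHs.
  suff -> : \sum_j (\prod_(m <- k :: s) (a j - a m)) *: e j = f w - a k *: w.
    by rewrite rpredB ?memvZ ?fU.
  rewrite linear_sum scaler_sumr -sumrB; apply: eq_bigr => j _.
  by rewrite big_cons linearZ /= fe !scalerA -scalerBl mulrBl [_ * a j]mulrC.
have := prodU (rem i (enum I)).
have remE k : (k \in rem i (enum I)) = (k != i).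
  by rewrite (mem_rem_uniq _ (enum_uniq I)) !inE mem_enum andbT.
rewrite (bigD1 i) //= [X in _ + X]big1 ?addr0 => [|j ji].
  (* Either the remaining coefficient of [e i] is zero or [e i] lies in [U]; a zero factor
     [a i - a k] with [k != i] would contradict injectivity of [a]. *)
  rewrite rpredZeq; case/orP=> //; rewrite prodf_seq_eq0.
  case/hasP=> k; rewrite remE subr_eq0 => ki /eqP/a_inj ik.
  by rewrite ik eqxx in ki.
suff /eqP-> : \prod_(k <- rem i (enum I)) (a j - a k) == 0 by rewrite scale0r.
by rewrite prodf_seq_eq0; apply/hasP; exists j; rewrite ?remE ?subrr /=.
Qed.

(** Polarization: expand [lie (x + y) (x + y) = 0]. *)
Lemma lieC (K : fieldType) (g : lieAlgType K) (x y : g) :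
  lie x y = - lie y x.
Proof.
have lieDl (u w t : g) : lie (u + w) t = lie u t + lie w t.
  by have := lie_linearl t 1 u w; rewrite !scale1r.
apply/eqP; rewrite -addr_eq0; apply/eqP.
by have := liexx (x + y); rewrite lieDl !linearD /= !liexx add0r addr0.
Qed.

(** Linearity is registered for the right argument only, so the sum is moved there by [lieC]. *)
Lemma lie_suml (K : fieldType) (g : lieAlgType K) (I : finType)
    (c : I -> K) (u : I -> g) (y : g) :
  lie (\sum_i c i *: u i) y = \sum_i c i *: lie (u i) y.
Proof.
rewrite lieC linear_sum -sumrN; apply: eq_bigr => i _.
by rewrite linearZ /= [lie y _]lieC scalerN opprK.
Qed.

Theorem proposition2p2 (K : fieldType) (charK0 : [pchar K] =i pred0)
    (g : lieAlgType K) (ssg : semisimple g)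
    (H : {vspace g}) (splitH : split_cartan_subalgebra H)
    (l : nat) (alpha : 'I_l -> dual H) (simple_alpha : simple_roots alpha)
    (C : 'M[int]_l) (cartanC : cartan_matrix alpha C)
    (h xp xm : 'I_l -> g) (cangen : canonical_generators alpha C h xp xm)
    (b : 'cV[K]_l) (b_neq0 : forall i, b i 0 <> 0)
    (v := map_mx intr C *m b : 'cV[K]_l)
    (v_uniq : uniq ([seq v i 0 | i <- enum 'I_l] ++
                    [seq - v i 0 | i <- enum 'I_l])) :
  lie_generates [:: \sum_i xp i; \sum_i b i 0 *: xm i].
Proof.
move=> U subU genU.
have xU : \sum_i xp i \in U by apply: genU; rewrite inE eqxx.
have yU : \sum_i b i 0 *: xm i \in U by apply: genU; rewrite !inE eqxx orbT.
pose z := \sum_i b i 0 *: h i.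
have zU : z \in U.
  suff -> : z = lie (\sum_i xp i) (\sum_i b i 0 *: xm i) by apply: subU.
  rewrite linear_sum; apply: eq_bigr => i _; rewrite linearZ /=; congr (_ *: _).
  (* The scalar 1 brings the sum into the form required by [lie_suml]; then only the term [j = i]
     survives. *)
  under [X in lie X _]eq_bigr => j _ do rewrite -[xp j]scale1r.
  rewrite lie_suml (bigD1 i) //= big1 => [|j ji].
    by rewrite (cangen_xpxm cangen) eqxx scale1r addr0.
  by rewrite (cangen_xpxm cangen) (negPf ji) scaler0.
have adzU u : u \in U -> lie z u \in U by apply: subU.
have adz_xp j : lie z (xp j) = v j 0 *: xp j.
  rewrite lie_suml mxE scaler_suml; apply: eq_bigr => i _.
  by rewrite (cangen_hxp cangen) scalerA mxE mulrC.
have adz_xm j : lie z (b j 0 *: xm j) = - v j 0 *: (b j 0 *: xm j).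
  rewrite linearZ /= lie_suml mxE -sumrN !scaler_suml scaler_sumr.
  apply: eq_bigr => i _.
  rewrite (cangen_hxm cangen) mxE !scalerA mulrN mulNr.
  by rewrite [in LHS]mulrC [b j 0 * _]mulrC mulrA.
have v_inj : injective (fun i => v i 0).
  move: v_uniq; rewrite cat_uniq => /andP[/injectiveP]; exact.
have xpU := @memv_eigenvector_sum _ _ (lie z) _ _ _ _ adzU adz_xp v_inj xU.
have xmU i : xm i \in U.
  (* The eigenvalues [- v j 0] are distinct because negation is injective. This gives
     [b i 0 *: xm i] in [U], and the nonzero scalar can be divided out. *)
  have := @memv_eigenvector_sum _ _ (lie z) _ _ _ _ adzU adz_xm
            (inj_comp oppr_inj v_inj) yU i.
  by rewrite rpredZeq => /orP[/eqP/b_neq0|].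
have hU i : h i \in U.
  by have := subU _ _ (xpU i) (xmU i); rewrite (cangen_xpxm cangen) eqxx.
apply: (cangen_gen cangen) => // u; rewrite !mem_cat.
by case/or3P=> /codomP[i ->].
Qed.
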